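(* Let $A=(a_{ij})\in M_{n,n}(\mathbb{R})$ be a fixed matrix. Let $G$ be the simple undirected graph with $n$ vertices $v_1,\ldots,v_n$ in which distinct vertices $v_i$ and $v_j$ are adjacent if and only if at least one of $a_{ij}$, $a_{ji}$ is non-zero, and let $t$ be the number of connected components of $G$. Then there are exactly $2^{n-t}$ different matrices of the form $\varphi_{\vec{c}}(A)$, where $\vec{c}$ ranges over the vectors in $\{-1,1\}^n$ with $c_1=1$.
   Context: $M_{n,n}(\mathbb{R})$ is the set of real $n\times n$ matrices. For $\vec{c}=(c_1,\ldots,c_n)\in\{-1,1\}^n$ with $c_1=1$, the map $\varphi_{\vec{c}}:M_{n,n}(\mathbb{R})\to M_{n,n}(\mathbb{R})$ is defined by $(\varphi_{\vec{c}}(A))_{ij}=c_i\,a_{ij}\,c_j$. *)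

(* Defs.v *)
From mathcomp Require Import all_boot all_order all_algebra.
From mathcomp Require Import classical_sets reals.

Set Implicit Arguments.
Unset Strict Implicit.
Unset Printing Implicit Defensive.

Import GRing.Theory.
Local Open Scope ring_scope.
Local Open Scope classical_set_scope.

(* Size n.+1, so that the first coordinate (index ord0) exists. *)
Definition sign_vectors (R : realType) (n : nat) : set 'rV[R]_n.+1 :=
  [set c : 'rV[R]_n.+1 |
    (forall i, c ord0 i = -1 \/ c ord0 i = 1) /\ c ord0 ord0 = 1].

Arguments sign_vectors R n : clear implicits.

Definition phi (R : realType) (n : nat) (c : 'rV[R]_n) (A : 'M[R]_n) :
    'M[R]_n :=
  \matrix_(i, j) (c ord0 i * A i j * c ord0 j).

Definition adj (R : realType) (n : nat) (A : 'M[R]_n) : rel 'I_n :=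
  fun i j => (i != j) && ((A i j != 0) || (A j i != 0)).

Lemma adj_irrefl (R : realType) (n : nat) (A : 'M[R]_n) : irreflexive (adj A).
Proof. by move=> i; rewrite /adj eqxx. Qed.

Lemma adj_sym (R : realType) (n : nat) (A : 'M[R]_n) : symmetric (adj A).
Proof. by move=> i j; rewrite /adj eq_sym orbC. Qed.

(* fingraph's n_comp counts components only when connect is symmetric. *)
Lemma adj_connect_sym (R : realType) (n : nat) (A : 'M[R]_n) :
  connect_sym (adj A).
Proof. exact: sym_connect_sym (@adj_sym R n A). Qed.

Definition num_components (R : realType) (n : nat) (A : 'M[R]_n) : nat :=
  n_comp (adj A) 'I_n.

(* Main.v *)
(* Conjugating by c multiplies a_ij by c_i c_j, so phi_c(A) only depends on the
   products c_i c_j along edges of the graph, hence on c up to a sign on each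
   connected component.  Encode c up to global sign by the vertex set S where
   it is negative; each class has exactly one representative S that contains no
   root, where one root is fixed in each component.  There are n - t vertices
   that are not roots. *)
Require Import Defs.
From mathcomp Require Import all_boot all_order all_algebra.
From mathcomp Require Import classical_sets cardinality reals.

Local Open Scope classical_set_scope.
Local Open Scope card_scope.

Lemma card_eq_finset (T : finType) (B : {set T}) : [set` B] #= `I_#|B|.
Proof.
have -> : [set` B] = [set enum_val i | i in [set: 'I_#|B|]].
  apply/seteqP; split => [x /= xB|_ /= [i _ <-]]; last exact: enum_valP.
  by exists (enum_rank_in xB x) => //; rewrite enum_rankK_in.
apply: (card_eq_trans (inj_card_eq (in2W enum_val_inj))).
by rewrite card_eq_sym card_II.
Qed.

Section SignedConjugation.
Import GRing.Theory Num.Theory.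
Local Open Scope ring_scope.
Variables (R : realType) (n : nat).
Implicit Types (S : {set 'I_n.+1}) (A : 'M[R]_n.+1) (c : 'rV[R]_n.+1).

(* The (+) with [ord0 \in S] makes the first coordinate 1; it does not affect phi. *)
Definition sign_vector S : 'rV[R]_n.+1 :=
  \row_i (-1) ^+ ((i \in S) (+) (ord0 \in S)).

Lemma sign_vectorP S : sign_vectors R n (sign_vector S).
Proof.
split=> [i|]; rewrite mxE ?addbb //.
by case: (_ (+) _); [left | right].
Qed.

Lemma phi_sign_vectorE S A i j :
  phi (sign_vector S) A i j = (-1) ^+ ((i \in S) (+) (j \in S)) * A i j.
Proof.
by rewrite !mxE mulrAC -signr_addb addbACA addbb addbF.
Qed.

(** A nonzero entry reveals the sign in front of it, hence whether [S] separates its two indices.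
    Along a path these parities add up, since each intermediate vertex occurs twice. *)
Lemma phi_sign_vector_connect S S' A i j :
    phi (sign_vector S) A = phi (sign_vector S') A -> connect (adj A) i j ->
  (i \in S) (+) (j \in S) = (i \in S') (+) (j \in S').
Proof.
move=> eqSS'.
have same k l : A k l != 0 ->
    (k \in S) (+) (l \in S) = (k \in S') (+) (l \in S').
  move=> Akl; have := congr1 (fun M : 'M_n.+1 => M k l) eqSS'.
  by rewrite !phi_sign_vectorE => /(mulIf Akl)/signr_inj.
have edge k l : adj A k l -> (k \in S) (+) (l \in S) = (k \in S') (+) (l \in S').
  by case/andP=> _ /orP[/same //|/same]; rewrite addbC => ->; rewrite addbC.
case/connectP=> p; elim: p i => [|k p IHp] i /= => [_ ->|]; first by rewrite !addbb.
case/andP=> /edge ik /IHp/[apply] kj.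
have split_at T : (i \in T) (+) (j \in T) =
    ((i \in T) (+) (k \in T)) (+) ((k \in T) (+) (j \in T)).
  by rewrite addbA -(addbA (i \in T)) addbb addbF.
by rewrite !split_at ik kj.
Qed.

Definition nonroots A : {set 'I_n.+1} :=
  finset (fun i => i \notin roots (adj A)).

Lemma card_nonroots A : #|nonroots A| = (n.+1 - num_components A)%N.
Proof.
rewrite cardsCs card_ord; congr (_ - _)%N.
by apply: eq_card => i; rewrite !inE negbK andbT.
Qed.

(** Each vertex is connected to its root, which lies in neither set, so the parity of this pair is
    the membership of the vertex. *)
Lemma phi_sign_vector_inj A :
  {in powerset (nonroots A) &, injective (fun S => phi (sign_vector S) A)}.
Proof.
have rootF S i : S \in powerset (nonroots A) -> (fingraph.root (adj A) i \in S) = false.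
  rewrite inE => /fintype.subsetP sub; apply/negbTE/negP=> /sub.
  by rewrite !inE (roots_root (adj_connect_sym A)).
move=> S S' SW S'W /phi_sign_vector_connect eqSS'; apply/setP=> i.
have := eqSS' _ _ (connect_root (adj A) i).
by rewrite !rootF // !addbF.
Qed.

Lemma sign_vector_phi A c : sign_vectors R n c ->
  exists2 S, S \in powerset (nonroots A) & phi c A = phi (sign_vector S) A.
Proof.
case=> signc _; set r := fingraph.root (adj A).
have cE i : c ord0 i = (-1) ^+ (c ord0 i != 1).
  by case: (signc i) => ->; rewrite ?eqxx // eqNr oner_eq0.
(* The negative set of [c] after flipping every component whose root is negative. *)
exists (finset (fun i => (c ord0 i != 1) (+) (c ord0 (r i) != 1))).
  rewrite inE; apply/fintype.subsetP=> i; rewrite !inE; apply: contraL => /eqP ri.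
  by rewrite /r ri addbb.
apply/matrixP=> i j; rewrite phi_sign_vectorE mxE !inE.
have [->|Aij] := eqVneq (A i j) 0; first by rewrite !(mulr0, mul0r).
(* With equal roots the two root terms cancel. Diagonal entries are a separate case because the
   graph has no loops. *)
have -> : r j = r i.
  have [-> //|neq_ij] := eqVneq i j; apply/esym/(fingraph.rootP (adj_connect_sym A)).
  by apply: connect1; rewrite /adj neq_ij Aij.
by rewrite addbACA addbb addbF signr_addb -!cE mulrAC.
Qed.

End SignedConjugation.

Theorem theorem19 (R : realType) (n : nat) (A : 'M[R]_n.+1) :
  [set phi c A | c in sign_vectors R n]
    #= `I_(2 ^ (n.+1 - num_components A)).
Proof.
(* Reindexing by sets of non-roots makes the parametrisation injective. *)
have -> : [set phi c A | c in sign_vectors R n] =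
    [set phi (sign_vector R n S) A | S in [set` powerset (nonroots R n A)]].
  apply/seteqP; split=> X /= [].
    by move=> c /(sign_vector_phi R n A)[S SW ->] <-; exists S.
  by move=> S _ <-; exists (sign_vector R n S) => //; exact: sign_vectorP.
rewrite -card_nonroots -card_powerset.
apply: card_eq_trans (card_eq_finset _ _).
apply: inj_card_eq => S S'; rewrite !mem_setE.
exact: phi_sign_vector_inj.
Qed.
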